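(* Let $\mathcal{F}_n$ denote the set of topological equivalence classes of generic 3D mosaic floor plans with $n$ blocks. Then \[ \log |\mathcal{F}_n| \leq 3n \log n + O(n). \]
   Context: A 3D mosaic floor plan with $n$ blocks is a partition of an axis-parallel box $H=[0,a]\times[0,b]\times[0,c]$ (the host box) into $n$ axis-parallel boxes (the blocks) with pairwise disjoint interiors. A corner is a point that is a vertex of at least one block. A corner is generic if the combinatorial shape of the local arrangement of the blocks around it is stable under every sufficiently small perturbation of the blocks adjacent to it (the perturbation is local and need not extend to the whole floor plan). A floor plan is generic if all its corners are generic. Two faces of blocks are attached if their intersection has positive area; a dissection plane is the union of the faces in one class of the equivalence relation generated by attachment. For each coordinate direction, the dissection graph in that direction is the directed multigraph whose vertices are the dissection planes orthogonal to that direction, with one edge for each block, joining the two dissection planes containing the two faces of the block orthogonal to that direction and oriented towards the one with larger coordinate. Two floor plans are topologically equivalent if for each of the three coordinate directions their dissection graphs are isomorphic. *)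

(* Defs.v *)
From HB Require Import structures.
From mathcomp Require Import all_boot all_order all_algebra.
From mathcomp Require Import all_classical all_reals all_analysis.

Set Implicit Arguments.
Unset Strict Implicit.
Unset Printing Implicit Defensive.

Import Order.TTheory GRing.Theory Num.Theory.
Import numFieldNormedType.Exports.

Local Open Scope classical_set_scope.
Local Open Scope ring_scope.

Section Boxes.
Variable R : realType.

Record box := Box {
  lo : 'rV[R]_3;
  hi : 'rV[R]_3;
  lo_lt_hi : forall k, lo 0 k < hi 0 k
}.

Definition box_set (B : box) : set 'rV[R]_3 :=
  [set x | forall k, lo B 0 k <= x 0 k <= hi B 0 k].

Definition is_vertex (B : box) (p : 'rV[R]_3) : Prop :=
  forall k, p 0 k = lo B 0 k \/ p 0 k = hi B 0 k.

End Boxes.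

(* The blocks are listed in an arbitrary order; topological equivalence below
   does not depend on it. *)
Record floorplan (R : realType) (n : nat) := Floorplan {
  host : box R;
  block : 'I_n -> box R;
  host_lo0 : lo host = 0;
  block_cover : \bigcup_i box_set (block i) = box_set host;
  block_disjoint : forall i j, i != j ->
    interior (box_set (block i)) `&` interior (box_set (block j)) = set0
}.

Section Genericity.
Variables (R : realType) (n : nat).
Implicit Types (F : floorplan R n) (p : 'rV[R]_3) (B : 'I_n -> box R).

Definition corner F p : Prop := exists i, is_vertex (block F i) p.

Definition adjacent_blocks F p : set 'I_n := [set i | box_set (block F i) p].

(* B is an arrangement of the blocks adjacent to p (the other values of B are
   irrelevant), each moved by less than e, that still tiles the host box inside
   the neighbourhood U of p.  Nothing is required outside U apart from the
   moved blocks not overlapping each other. *)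
Definition local_perturbation F p (U : set 'rV[R]_3) (e : R) B : Prop :=
  [/\ forall i, adjacent_blocks F p i ->
        `|lo (B i) - lo (block F i)| < e /\ `|hi (B i) - hi (block F i)| < e,
      forall i j, adjacent_blocks F p i -> adjacent_blocks F p j -> i != j ->
        interior (box_set (B i)) `&` interior (box_set (B j)) = set0 &
      U `&` \bigcup_(i in adjacent_blocks F p) box_set (B i) = U `&` box_set (host F)].

Definition extends_along (A : set 'rV[R]_3) (k : 'I_3) : Prop :=
  exists x y, [/\ A x, A y & x 0 k != y 0 k].

(* The combinatorial shape of an arrangement of boxes: which of them have a
   common point, and whether this common intersection is a point, a segment, a
   rectangle or a box, and parallel to which axes. *)
Definition same_shape (I : set 'I_n) B B' : Prop :=
  forall S : set 'I_n, S `<=` I -> S !=set0 ->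
    let M := \bigcap_(i in S) box_set (B i) in
    let M' := \bigcap_(i in S) box_set (B' i) in
    (M !=set0 <-> M' !=set0) /\
    (forall k, extends_along M k <-> extends_along M' k).

Definition generic_corner F p : Prop :=
  forall U, nbhs p U -> exists2 e : R, 0 < e &
    forall B, local_perturbation F p U e B ->
      same_shape (adjacent_blocks F p) (block F) B.

Definition generic F : Prop := forall p, corner F p -> generic_corner F p.

End Genericity.

Record multidigraph := Multidigraph {
  vertex : Type;
  edge : Type;
  source : edge -> vertex;
  target : edge -> vertex
}.

Definition multidigraph_iso (G H : multidigraph) : Prop :=
  exists (f : vertex G -> vertex H) (g : edge G -> edge H),
    [/\ bijective f, bijective g,
        forall e, f (source e) = source (g e) &
        forall e, f (target e) = target (g e)].

Section Dissection.
Variables (R : realType) (n : nat) (F : floorplan R n) (k : 'I_3).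

(* (i, true) and (i, false) stand for the upper and the lower face of block i
   orthogonal to direction k.  Faces orthogonal to different directions meet in
   area 0, so attachment never relates them and can be treated one direction
   at a time. *)
Definition face_coord (f : 'I_n * bool) : R :=
  if f.2 then hi (block F f.1) 0 k else lo (block F f.1) 0 k.

Definition face_set (f : 'I_n * bool) : set 'rV[R]_3 :=
  [set x | box_set (block F f.1) x /\ x 0 k = face_coord f].

(* The area of face_set f `&` face_set g. *)
Definition meet_area (f g : 'I_n * bool) : R :=
  if face_coord f == face_coord g then
    \prod_(l < 3 | l != k)
      Num.max 0 (Num.min (hi (block F f.1) 0 l) (hi (block F g.1) 0 l)
               - Num.max (lo (block F f.1) 0 l) (lo (block F g.1) 0 l))
  else 0.

Definition attached : rel ('I_n * bool) := [rel f g | 0 < meet_area f g].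

(* attached is symmetric, so its reflexive transitive closure connect is the
   equivalence relation it generates.  A face on the boundary of the host box is
   attached to no other face and so is a dissection plane by itself: a source or
   sink of degree 1.  Interior planes have blocks on both sides, so merging all
   these sources (resp. sinks) into one vertex yields the same notion of
   isomorphism. *)
Definition dissection_plane (f : 'I_n * bool) : set 'rV[R]_3 :=
  \bigcup_(g in [set g | connect attached f g]) face_set g.

Definition plane_vertex (f : 'I_n * bool) : set_type (range dissection_plane) :=
  SigSub (mem_set (imageT dissection_plane f)).

Definition dissection_graph : multidigraph :=
  {| vertex := set_type (range dissection_plane);
     edge := 'I_n;
     source := fun i => plane_vertex (i, false);
     target := fun i => plane_vertex (i, true) |}.

End Dissection.

Definition top_equiv (R : realType) (n : nat) (F G : floorplan R n) : Prop :=
  forall k : 'I_3,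
    multidigraph_iso (dissection_graph F k) (dissection_graph G k).

Definition generic_classes (R : realType) (n : nat) : set (set (floorplan R n)) :=
  [set [set G | generic G /\ top_equiv F G] | F in [set F | generic F]].

Arguments generic_classes : clear implicits.

(* Main.v *)
Require Import Defs.
From mathcomp Require Import all_boot all_order all_algebra perm finmap.
From mathcomp Require Import all_classical all_reals all_analysis.

Import Order.TTheory GRing.Theory Num.Theory.
Local Open Scope classical_set_scope.
Local Open Scope ring_scope.

(** In each direction the dissection graph has [n] edges and no isolated
    vertex, hence at most [2n] vertices. Naming every vertex by one of the [2n]
    faces, the graph is determined up to isomorphism by the multiset of its [n]
    edges, taken among [4n^2] pairs of names. Forgetting the order of the edges
    saves a factor [n!], so there are at most
    [(5n^2)^n / n! <= (20n)^n] graphs, and [(20n)^(3n)] triples of graphs. *)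

(** Every factor of [(n + n) ^_ n] is at least [n], and this product is n factorial times
    ['C(n + n, n)], one term of the expansion of [(1 + 1) ^ (n + n)]. *)
Lemma leq_expnn_fact (n : nat) : (n ^ n <= 4 ^ n * n`!)%N.
Proof.
have bin_le : ('C(n + n, n) <= 4 ^ n)%N.
  rewrite -[4%N]/(2 ^ 2)%N -expnM mul2n -addnn -[2%N]/(1 + 1)%N expnDn.
  have ltn : (n < (n + n).+1)%N by rewrite ltnS leq_addr.
  by rewrite (bigD1 (Ordinal ltn)) //= !exp1n !muln1 leq_addr.
apply: (@leq_trans ((n + n) ^_ n)); last by rewrite -bin_ffact leq_mul2r bin_le orbT.
rewrite ffact_prod -[X in (_ ^ X <= _)%N]card_ord -prod_nat_const.
by apply: leq_prod => i _; rewrite -addnBA ?leq_addr // ltnW.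
Qed.

(** After multiplication by [n ^ n]: ['C(m, n) * n ^ n <= 4 ^ n * m ^_ n <= 4 ^ n * m ^ n], where
    [m <= 5 * n ^ 2]. *)
Lemma leq_multiset_count (n : nat) :
  (0 < n)%N -> ('C(n + (n * 2) * (n * 2), n) <= (20 * n) ^ n)%N.
Proof.
move=> n0; set m := (n + _)%N.
have m_le : (m <= 5 * (n * n))%N.
  rewrite /m mulnACA [X in (_ <= X)%N]mulSn mulnC leq_add2r.
  by rewrite -[X in (X <= _)%N]muln1 leq_mul2l n0 orbT.
have ffact_le : (m ^_ n <= m ^ n)%N.
  rewrite ffact_prod -[X in (_ <= _ ^ X)%N]card_ord -prod_nat_const.
  by apply: leq_prod => i _; apply: leq_subr.
have nn0 : (0 < n ^ n)%N by rewrite expn_gt0 n0.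
rewrite -(leq_pmul2r nn0).
apply: (@leq_trans ('C(m, n) * (4 ^ n * n`!))).
  by rewrite leq_mul2l leq_expnn_fact orbT.
rewrite mulnCA bin_ffact.
apply: (@leq_trans (4 ^ n * m ^ n)); first by rewrite leq_mul2l ffact_le orbT.
rewrite -!expnMn leq_exp2r //.
by rewrite -mulnA -[20%N]/(4 * 5)%N -mulnA leq_mul2l.
Qed.

(* One symbol of slack (['C(n + #|E|, n)] instead of ['C(n + #|E| - 1, n)])
   avoids a separate case for an empty [E]. *)
Lemma multiset_code (E : finType) (n : nat) :
  exists (M : finType) (c : n.-tuple E -> M),
    #|M| = 'C(n + #|E|, n) /\ forall s t, c s = c t -> perm_eq s t.
Proof.
pose I := 'I_(#|E|).+1.
pose code (e : E) : I := widen_ord (leqnSn _) (enum_rank e).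
have code_inj : injective code.
  by move=> x y /(congr1 val) /= /val_inj /enum_rank_inj.
pose le : rel I := relpre val leq.
have le_total : total le by move=> x y; exact: leq_total.
have le_trans : transitive le by move=> x y z; exact: leq_trans.
have le_anti : antisymmetric le by move=> x y /anti_leq /val_inj.
pose P (t : n.-tuple I) := sorted leq (map val t).
(* The sorted arrangement is a canonical form of the multiset. *)
pose srt (s : n.-tuple E) : n.-tuple I := sort_tuple le (map_tuple code s).
have srtP s : P (srt s) by rewrite /P sorted_map; exact: sort_sorted.
exists {t : n.-tuple I | P t}, (fun s => exist _ (srt s) (srtP s)); split.
  by rewrite card_sig -(card_sorted_tuples n #|E|); apply: eq_card => t; rewrite !inE.
move=> s t /(congr1 (fun u => tval (val u))) /=.
by move/(perm_sortP le_total le_trans le_anti)/(perm_map_inj code_inj).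
Qed.

(** The code of a chosen preimage determines the value of [f], so the image of [A] injects into [C],
    even when [A] is infinite. *)
Lemma card_image_factor (T : Type) (U : choiceType) (C : finType)
    (A : set T) (f : T -> U) (c : T -> C) :
  (forall x y, A x -> A y -> c x = c y -> f x = f y) ->
  finite_set (f @` A) /\ (#|` fset_set (f @` A)| <= #|C|)%N.
Proof.
move=> fc.
have fA_le : (f @` A #<= `I_#|C|)%card.
  (* The default 0 is harmless: injectivity is needed only on the image of [A]. *)
  pose g u := if pselect (exists2 x, A x & f x = u) is left h
              then nat_of_ord (enum_rank (c (projT1 (cid2 h)))) else 0%N.
  have g_inj : {in f @` A &, injective g}.
    move=> u v /set_mem uA /set_mem vA; rewrite /g.
    case: pselect => // hu; case: pselect => // hv.
    case: (cid2 hu) (cid2 hv) => x Ax fx [y Ay fy] /= /val_inj/enum_rank_inj.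
    by rewrite -fx -fy; exact: fc.
  rewrite -(card_le_eql (inj_card_eq g_inj)).
  apply: subset_card_le => _ [u uA <-]; rewrite /g /=.
  by case: pselect => // h; exact: ltn_ord.
split; last exact: geq_card_fset_set.
by apply/finite_set_leP; exists #|C|.
Qed.

Lemma multidigraph_iso_sym (G H : multidigraph) :
  multidigraph_iso G H -> multidigraph_iso H G.
Proof.
move=> [f [g [[f' fK f'K] [g' gK g'K] fs ft]]].
exists f', g'; split; [by exists f | by exists g | |] => e.
  by rewrite -{1}(g'K e) -fs fK.
by rewrite -{1}(g'K e) -ft fK.
Qed.

Lemma multidigraph_iso_trans (G H K : multidigraph) :
  multidigraph_iso G H -> multidigraph_iso H K -> multidigraph_iso G K.
Proof.
move=> [f [g [bf bg fs ft]]] [f' [g' [bf' bg' fs' ft']]].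
exists (f' \o f), (g' \o g); split; [exact: bij_comp | exact: bij_comp | |] => e.
  by rewrite /= fs fs'.
by rewrite /= ft ft'.
Qed.

(** Both [U] and [V] are the quotient of [T] by the common kernel; each map composed with a section
    of the other gives the two inverse bijections. *)
Lemma bijective_same_kernel (T U V : Type) (u : T -> U) (v : T -> V) :
  (forall y, exists x, u x = y) -> (forall z, exists x, v x = z) ->
  (forall x x', u x = u x' <-> v x = v x') ->
  exists f : U -> V, bijective f /\ forall x, f (u x) = v x.
Proof.
move=> /choice[u' u'K] /choice[v' v'K] uv.
exists (v \o u'); split; last by move=> x /=; apply/uv; rewrite u'K.
exists (u \o v') => [y | z] /=.
  by rewrite -[RHS]u'K; apply/uv; rewrite v'K.
by rewrite -[RHS]v'K; apply/uv; rewrite u'K.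
Qed.

Section EndpointGraph.
Variable n : nat.
Let T : Type := ('I_n * bool)%type.

(** For [v := plane_vertex F k] this unfolds to [dissection_graph F k]. *)
Definition endpoint_graph (V : Type) (v : T -> V) : multidigraph :=
  {| vertex := V; edge := 'I_n;
     source := fun i => v (i, false); target := fun i => v (i, true) |}.

Definition edge_names (l : T -> T) : n.-tuple (T * T) :=
  [tuple (l (i, false), l (i, true)) | i < n].

(** Here [l] and [m] name the vertices. A permutation of the edges that matches the names also
    matches coincidences of endpoints, so it induces a bijection of the vertices. *)
Lemma endpoint_graph_iso (V W : Type) (v : T -> V) (w : T -> W) (l m : T -> T) :
  (forall y, exists x, v x = y) -> (forall y, exists x, w x = y) ->
  (forall x x', l x = l x' <-> v x = v x') ->
  (forall x x', m x = m x' <-> w x = w x') ->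
  perm_eq (edge_names l) (edge_names m) ->
  multidigraph_iso (endpoint_graph V v) (endpoint_graph W w).
Proof.
move=> vs ws lv mw /tuple_permP[p /val_inj lm].
pose q (x : T) : T := (p x.1, x.2).
have lmq x : l x = m (q x).
  case: x => i b; have := congr1 (fun t => tnth t i) lm.
  by rewrite !tnth_mktuple => -[]; case: b.
have wqs y : exists x, (w \o q) x = y.
  have [[i b] <-] := ws y.
  by exists ((p^-1)%g i, b); rewrite /q /= permKV.
have [x x'|f [bf fE]] := bijective_same_kernel T V W v (w \o q) vs wqs.
  by rewrite -lv !lmq mw.
by exists f, p; split=> // [|e|e]; [exact: injF_bij perm_inj | exact: fE | exact: fE].
Qed.

End EndpointGraph.

Lemma card_generic_classes (R : realType) (n : nat) : (0 < n)%N ->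
  finite_set (generic_classes R n) /\
  (#|` fset_set (generic_classes R n)| <= ((20 * n) ^ n) ^ 3)%N.
Proof.
move=> n0.
have vs (F : floorplan R n) k y : exists x, plane_vertex F k x = y.
  case: y => y yP; have [x _ xy] := set_mem yP.
  by exists x; apply: val_inj.
(* A plane is named by one chosen face among those that yield it. *)
pose l F k x : 'I_n * bool := projT1 (cid (vs F k (plane_vertex F k x))).
have lP F k x x' : l F k x = l F k x' <-> plane_vertex F k x = plane_vertex F k x'.
  rewrite /l; split=> [e | -> //].
  have := congr1 (plane_vertex F k) e.
  by case: cid => z /= ->; case: cid => z' /= ->.
have [M [c [cardM cP]]] := multiset_code (('I_n * bool) * ('I_n * bool))%type n.
pose code F : {ffun 'I_3 -> M} := [ffun k => c (edge_names n (l F k))].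
have codeP F G : code F = code G -> top_equiv F G.
  move=> /ffunP FG k; have := FG k; rewrite !ffunE => /cP.
  by apply: endpoint_graph_iso; [exact: vs | exact: vs | exact: lP | exact: lP].
(* Plans with equal codes are equivalent, hence have the same class. *)
have [|fin card] := card_image_factor _ _ _ [set F : floorplan R n | generic F]
  (fun F => [set G | generic G /\ top_equiv F G]) code.
  move=> F F' _ _ /codeP FF'; apply/seteqP; split=> G [gG FG]; split=> // k.
    exact: multidigraph_iso_trans (multidigraph_iso_sym _ _ (FF' k)) (FG k).
  exact: multidigraph_iso_trans (FF' k) (FG k).
split=> //; apply: leq_trans card _.
rewrite card_ffun card_ord cardM !card_prod card_ord card_bool leq_exp2r //.
exact: leq_multiset_count.
Qed.

Theorem theorem1 (R : realType) :
  exists C : R, forall n : nat, (0 < n)%N ->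
    finite_set (generic_classes R n) /\
    ln (#|` fset_set (generic_classes R n)|%:R : R)
      <= 3 * n%:R * ln n%:R + C * n%:R.
Proof.
(* The logarithm of [(20 * n) ^ (3 * n)] is [3 * n * ln n + 3 * ln 20 * n]. *)
exists (3 * ln 20) => n n0.
have [fin card] := card_generic_classes R n n0; split=> //.
have npos : (0 : R) < n%:R by rewrite ltr0n.
have -> : 3 * n%:R * ln n%:R + 3 * ln 20 * n%:R
    = ln (((20 * n) ^ n) ^ 3)%:R :> R.
  rewrite -expnM natrX lnXn ?ltr0n ?muln_gt0 //.
  rewrite natrM lnM ?posrE // ?ltr0n // -(mulr_natl _ (n * 3)) natrM.
  by rewrite mulrDr addrC; congr (_ + _); rewrite mulrC mulrA mulrC mulrA mulrAC.
have pos : (0 < ((20 * n) ^ n) ^ 3)%N by rewrite !expn_gt0 muln_gt0 n0.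
(* For an empty set of classes [ln 0] is 0 by convention, and the bound is nonnegative. *)
have [->|m0] := posnP #|` fset_set (generic_classes R n)|.
  by rewrite ln0 // ln_ge0 // ler1n.
by rewrite ler_ln ?posrE ?ltr0n // ler_nat.
Qed.
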